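(* Let $\Theta\subseteq\mathbb R$ be an open interval containing $0$ and let $(F_\theta)_{\theta\in\Theta}$ be a family of continuous joint cdf's on $\mathbb R^2$ with common marginal cdf's $G$ and $H$ not depending on $\theta$, such that $F_0(x,y)=G(x)H(y)$ for all real $x,y$. Let $\Theta_0\subseteq\Theta$ be a neighborhood of $0$. Suppose that $\mu$ is a finite (nonnegative) measure on the Borel $\sigma$-algebra $\mathcal B(\mathbb R^2)$ and that, for each $\theta\in\Theta_0$, $F_\theta$ is absolutely continuous with respect to $\mu$ with density $f_\theta$, such that $\frac{\partial}{\partial\theta}f_\theta(x,y)$ (exists and) is uniformly bounded over $\theta\in\Theta_0$ and $(x,y)\in\mathbb R^2$. Then $$\frac1\theta\int_{\mathbb R^2}(F_\theta-F_0)\,d(F_\theta-F_0)\to0\quad\text{as }\theta\to0.$$ So, $\mathsf{ARE}_{T,S}(0)=1$ if, in addition, $$\liminf_{\theta\to0}\Big|\frac1\theta\int_{\mathbb R^2}(F_\theta-F_0)\,dF_0\Big|>0.$$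
   Context: Integrals against $dF_0$ and $d(F_\theta-F_0)$ are with respect to the probability measure with cdf $F_0$ and the signed measure which is the difference of the probability measures with cdf's $F_\theta$ and $F_0$; ''$F_\theta$ is absolutely continuous with respect to $\mu$'' means that the probability measure with cdf $F_\theta$ is. A neighborhood of $0$ here may be taken to be an open interval containing $0$. $\mathsf{ARE}_{T,S}(0)$ is the (two-sided Pitman) asymptotic relative efficiency, at the independence value $\theta=0$, of Kendall's correlation statistic $T$ relative to Spearman's correlation statistic $S$. With $(X,Y)$ having cdf $F_\theta$ under $\mathsf P_\theta$ (expectation $\mathsf E_\theta$, variance $\mathsf{Var}_\theta$), it is defined by $$\mathsf{ARE}_{T,S}(0):=\frac{\sigma_S^2(0)}{\sigma_T^2(0)}\lim_{\theta\to0}\frac{(\mu_T(\theta)-\mu_T(0))^2}{(\mu_S(\theta)-\mu_S(0))^2},$$ where $\mu_T(\theta)=4\,\mathsf E_\theta F_\theta(X,Y)-1$, $\mu_S(\theta)=12\,\mathsf E_\theta G(X)H(Y)-3$, $\sigma_T^2(\theta)=16\,\mathsf{Var}_\theta\big(2F_\theta(X,Y)-G(X)-H(Y)\big)$, and $$\sigma_S^2(\theta)=144\,\mathsf{Var}_\theta\Big((1-G(X))(1-H(Y))+\int_{\mathbb R}F_\theta(X,y)\,dH(y)+\int_{\mathbb R}F_\theta(x,Y)\,dG(x)\Big).$$ The assertion $\mathsf{ARE}_{T,S}(0)=1$ includes existence of the limit. *)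

(* Defs.v *)
From HB Require Import structures.
From mathcomp Require Import all_boot all_order all_algebra.
From mathcomp Require Import all_classical all_reals all_analysis.
Set Implicit Arguments.
Unset Strict Implicit.
Unset Printing Implicit Defensive.
Import Order.TTheory GRing.Theory Num.Theory.
Import numFieldNormedType.Exports.
Local Open Scope classical_set_scope.
Local Open Scope ring_scope.

(* The canonical (product) sigma-algebra of R * R is the Borel sigma-algebra of
   the plane. *)
HB.instance Definition _ (R : realType) :=
  isMeasurableFun.Build _ _ (R * R)%type R fst (@measurable_fst _ _ R R).
HB.instance Definition _ (R : realType) :=
  isMeasurableFun.Build _ _ (R * R)%type R snd (@measurable_snd _ _ R R).

(* A joint cdf determines, and is determined by, a Borel probability measure Q
   on the plane, the law of (X, Y); X and Y are the two coordinate functions. *)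
Definition coordX (R : realType) (Q : probability (R * R)%type R) :
    {RV Q >-> R} :=
  [the {mfun (R * R)%type >-> R} of fst].
Definition coordY (R : realType) (Q : probability (R * R)%type R) :
    {RV Q >-> R} :=
  [the {mfun (R * R)%type >-> R} of snd].

Definition joint_cdf (R : realType) (Q : probability (R * R)%type R)
    (z : R * R) : R :=
  fine (Q (`]-oo, z.1] `*` `]-oo, z.2])).

Definition cdfX (R : realType) (Q : probability (R * R)%type R) (x : R) : R :=
  fine (cdf (coordX Q) x).
Definition cdfY (R : realType) (Q : probability (R * R)%type R) (y : R) : R :=
  fine (cdf (coordY Q) y).

(* Integral against the signed measure Q1 - Q2. *)
Definition integral_diff (R : realType) (Q1 Q2 : probability (R * R)%type R)
    (f : R * R -> R) : R :=
  \int[Q1]_z f z - \int[Q2]_z f z.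

Definition has_density (R : realType)
    (mu : {finite_measure set (R * R)%type -> \bar R})
    (Q : probability (R * R)%type R) (f : R * R -> R) : Prop :=
  mu.-integrable setT (EFin \o f) /\
  (forall A : set (R * R)%type, measurable A ->
     Q A = (\int[mu]_(z in A) (f z)%:E)%E).

Section Pitman.
Variable R : realType.
Implicit Types Q : probability (R * R)%type R.

Definition mu_T Q : R := 4 * fine 'E_Q[joint_cdf Q] - 1.

Definition mu_S Q : R :=
  12 * fine 'E_Q[(fun z => cdfX Q z.1 * cdfY Q z.2)] - 3.

Definition sigma2_T Q : R :=
  16 * fine 'V_Q[(fun z => 2 * joint_cdf Q z - cdfX Q z.1 - cdfY Q z.2)].

(* The laws of X and Y under Q are the probability measures with cdf's
   cdfX Q and cdfY Q. *)
Definition sigma2_S Q : R :=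
  144 * fine 'V_Q[(fun z =>
    (1 - cdfX Q z.1) * (1 - cdfY Q z.2)
    + \int[distribution Q (coordY Q)]_y joint_cdf Q (z.1, y)
    + \int[distribution Q (coordX Q)]_x joint_cdf Q (x, z.2))].

Variable P : R -> probability (R * R)%type R.

Definition mean_shift_ratio (theta : R) : R :=
  (mu_T (P theta) - mu_T (P 0)) ^+ 2 / (mu_S (P theta) - mu_S (P 0)) ^+ 2.

(* Meaningful only when the limit exists. As division by 0 returns 0, a nonzero
   value forces sigma2_T (P 0) and, near 0, the denominators of
   mean_shift_ratio to be nonzero. *)
Definition ARE_TS : R :=
  sigma2_S (P 0) / sigma2_T (P 0) *
  lim (mean_shift_ratio theta @[theta --> 0^']).

End Pitman.

(* Main.v *)
(* Put D = F_theta - F_0, b(theta) the integral of D against dF_0 and r(theta)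
   its integral against d(F_theta - F_0).  By the mean value theorem
   |f_theta - f_0| <= M |theta|; integrating once over quadrants bounds D, and
   integrating D against the density difference gives |r| <= C theta^2.

   As the marginals of F_theta are common and continuous, the integrals of F_0
   against dF_theta and of F_theta against dF_0 agree.  Hence mu_T shifts by
   4 (r + 2 b) and mu_S by 12 b, and when |b / theta| stays away from 0 the
   squared ratio of the shifts tends to (2/3)^2.  Under independence the two
   variances are 16 V and 36 V, where V > 0 is the variance of
   2 F_0(X,Y) - G(X) - H(Y), and (36/16) (2/3)^2 = 1. *)
Require Import Defs.
From HB Require Import structures.
From mathcomp Require Import all_boot all_order all_algebra.
From mathcomp Require Import all_classical all_reals all_analysis.
From mathcomp Require Import measurable_realfun ring lra.
Import Order.TTheory GRing.Theory Num.Theory.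
Import numFieldNormedType.Exports.
Local Open Scope classical_set_scope.
Local Open Scope ring_scope.

(** * Measurability, product measures and bounded integrands *)

Lemma measurable_le_set {d} {T : measurableType d} {R : realType} (f g : T -> R) :
  measurable_fun setT f -> measurable_fun setT g ->
  measurable [set x | f x <= g x].
Proof.
move=> mf mg.
have := measurable_lee measurableT ((measurable_EFinP _ _).2 mf)
  ((measurable_EFinP _ _).2 mg).
by rewrite setTI; congr measurable; apply/seteqP; split => x /=; rewrite lee_fin.
Qed.

(** The product measure is built from x-sections. It agrees on rectangles with the one built from
    y-sections, so uniqueness lets either order of integration be used. *)
Lemma product_measure_ysection {d1 d2} {T1 : measurableType d1}
    {T2 : measurableType d2} {R : realType}
    (P1 : probability T1 R) (P2 : probability T2 R) (A : set (T1 * T2)) :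
  measurable A -> (P1 \x P2)%E A = (\int[P2]_y P1 (ysection A y))%E.
Proof.
move=> mA; rewrite (@product_measure_unique _ _ _ _ _ P1 P2 (P1 \x^ P2)%E)//.
by move=> B C mB mC; exact: product_measure2E.
Qed.

Lemma bounded_integrable {d} {T : measurableType d} {R : realType}
    (mu : {finite_measure set T -> \bar R}) (f : T -> R) (c : R) :
  measurable_fun setT f -> (forall x, `|f x| <= c) ->
  mu.-integrable setT (EFin \o f).
Proof.
move=> mf fc; apply: measurable_bounded_integrable => //.
  by rewrite ltey_eq fin_num_measure.
exists c; split; first exact: num_real.
by move=> y cy x _ /=; rewrite (le_trans (fc x))// ltW.
Qed.

(** * Real random variables with a continuous cdf *)

Lemma fine_cdfK {d} {T : measurableType d} {R : realType}
    {P : probability T R} (X : {RV P >-> R}) (x : R) :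
  (fine (cdf X x))%:E = cdf X x.
Proof. by rewrite fineK// fin_num_measure//; exact: measurable_itv. Qed.

(** For [y < x] the event [X = x] has at most the mass of []y, x]], which is the increment of the
    cdf from [y] to [x]; left continuity at [x] makes it arbitrarily small. *)
Lemma cdf_atomless {d} {T : measurableType d} {R : realType}
    {P : probability T R} (X : {RV P >-> R}) (x : R) :
  continuous (fun x => fine (cdf X x)) -> P (X @^-1` [set x]) = 0%E.
Proof.
move=> cX.
apply/eqP; rewrite eq_le measure_ge0 andbT; apply/lee_addgt0Pr => e e0.
rewrite add0e.
have /cvgrPdist_le /(_ e e0)/nbhs_ballP[r /= r0 xr] := cX x.
pose y := x - r / 2.
have yx : y < x by rewrite /y gtrBl divr_gt0.
have : `|fine (cdf X x) - fine (cdf X y)| <= e.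
  apply: xr; rewrite /ball/= /y opprB addrC subrK gtr0_norm ?divr_gt0//.
  by rewrite gtr_pMr// invf_lt1 ?ltr1n.
rewrite -lee_fin => /(le_trans _); apply.
apply: (@le_trans _ _ (P (X @^-1` `]y, x]))).
  apply: le_measure; rewrite ?inE.
  - exact: measurable_funPTI.
  - exact: measurable_funPTI.
  - by move=> t /= ->; rewrite in_itv/= yx lexx.
have -> : X @^-1` `]y, x] = X @^-1` `]-oo, x] `\` X @^-1` `]-oo, y].
  apply/seteqP; split => t /=; rewrite !in_itv/=.
    by move=> /andP[yt ->]; split => //; apply/negP; rewrite -ltNge.
  by move=> [-> /negP]; rewrite -ltNge => ->.
rewrite measureD; [|exact: measurable_funPTI|exact: measurable_funPTI|].
  rewrite (_ : _ `&` _ = X @^-1` `]-oo, y]); last first.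
    apply/seteqP; split => t /=; rewrite !in_itv/=; first by case.
    by move=> ty; split => //; rewrite (le_trans ty)// ltW.
  rewrite [X in (X - _)%E](_ : _ = (fine (cdf X x))%:E); last by rewrite fine_cdfK.
  rewrite [X in (_ - X)%E](_ : _ = (fine (cdf X y))%:E); last by rewrite fine_cdfK.
  by rewrite lee_fin ler_norm.
by rewrite ltey_eq fin_num_measure//; exact: measurable_funPTI.
Qed.


Lemma cdf_atomless_lt {d} {T : measurableType d} {R : realType}
    {P : probability T R} (X : {RV P >-> R}) (x : R) :
  continuous (fun x => fine (cdf X x)) -> P (X @^-1` `]-oo, x[) = cdf X x.
Proof.
move=> cX; rewrite /cdf /distribution /pushforward.
have -> : X @^-1` `]-oo, x] = X @^-1` `]-oo, x[ `|` X @^-1` [set x].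
  apply/seteqP; split => t /=; rewrite !in_itv/= le_eqVlt.
    by move=> /orP[/eqP ->|->]; [right|left].
  by move=> [->|->]; rewrite ?eqxx ?orbT.
by rewrite measureU0//; [exact: measurable_funPTI..|exact: cdf_atomless].
Qed.

(* For independent copies X, X' of an atomless variable, P(X <= X') and
   P(X > X') are both equal to E F(X). *)
Lemma expectation_cdf {d} {T : measurableType d} {R : realType}
    {P : probability T R} (X : {RV P >-> R}) :
  continuous (fun x => fine (cdf X x)) ->
  \int[P]_t fine (cdf X (X t)) = 1 / 2.
Proof.
move=> cX.
pose U := [set p : T * T | X p.1 <= X p.2].
have mU : measurable U.
  by apply: measurable_le_set; apply: measurableT_comp.
have U1 : (P \x P)%E U = (\int[P]_t cdf X (X t))%E.
  rewrite product_measure_ysection//; apply: eq_integral => t _.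
  by rewrite ysectionE.
have U2 : (P \x P)%E (~` U) = (\int[P]_t cdf X (X t))%E.
  apply: eq_integral => t _ /=.
  rewrite xsectionE -(cdf_atomless_lt _ _ cX); congr (P _).
  apply/seteqP; split => s /=; rewrite in_itv/=.
    by move/negP; rewrite -ltNge.
  by rewrite ltNge => /negP.
have := probability_setC (P \x P)%E mU.
rewrite [in LHS]/= [LHS]U2 [X in (1 - X)%E]U1 /Rintegral.
have -> : (\int[P]_t (fine (cdf X (X t)))%:E = \int[P]_t cdf X (X t))%E.
  apply: eq_integral => t _; exact: fine_cdfK.
have : (\int[P]_t cdf X (X t))%E \is a fin_num.
  rewrite -U1.
  exact: (fin_num_measure [the probability (T * T)%type R of (P \x P)%E] U mU).
by case: (\int[P]_t _)%E => //= r _ [?]; lra.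
Qed.

Lemma measurable_fine_cdf {d} {T : measurableType d} {R : realType}
    {P : probability T R} (X : {RV P >-> R}) :
  measurable_fun setT (fun x => fine (cdf X x)).
Proof.
by apply: measurableT_comp; [exact: fine_measurable|exact: cdf_measurable].
Qed.

Lemma fine_probability_norm_le1 {d} {T : measurableType d} {R : realType}
    (P : probability T R) (A : set T) : measurable A -> `|fine (P A)| <= 1.
Proof.
move=> mA; rewrite ger0_norm ?fine_ge0// -lee_fin fineK ?fin_num_measure//.
exact: probability_le1.
Qed.

Lemma cdf_norm_le1 {d} {T : measurableType d} {R : realType}
    {P : probability T R} (X : {RV P >-> R}) (x : R) : `|fine (cdf X x)| <= 1.
Proof. by apply: fine_probability_norm_le1; exact: measurable_itv. Qed.

(** The section at [t] is the event [Y < X t]; without atoms and with equal cdf's its mass is the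
    cdf of [X] at [X t], whose mean is 1/2. *)
Lemma product_probability_gt {d1 d2} {T1 : measurableType d1}
    {T2 : measurableType d2} {R : realType} {P1 : probability T1 R}
    {P2 : probability T2 R} (X : {RV P1 >-> R}) (Y : {RV P2 >-> R}) :
  (fun x => fine (cdf X x)) = (fun x => fine (cdf Y x)) ->
  continuous (fun x => fine (cdf X x)) ->
  (P1 \x P2)%E (~` [set p | X p.1 <= Y p.2]) = (1 / 2)%:E.
Proof.
move=> XY cX; transitivity (\int[P1]_t (fine (cdf X (X t)))%:E)%E.
  apply: eq_integral => t _ /=.
  have -> : fine (cdf X (X t)) = fine (cdf Y (X t)).
    by have /funeqP := XY; exact.
  rewrite xsectionE fine_cdfK -cdf_atomless_lt -?XY//; congr (P2 _).
  apply/seteqP; split => s /=; rewrite in_itv/= ltNge; first by move/negP.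
  by move=> /negP.
rewrite -(expectation_cdf X)// fineK//; apply: integrable_fin_num => //.
apply: (bounded_integrable _ _ 1).
  exact: (measurableT_comp (measurable_fine_cdf X)).
by move=> t; exact: cdf_norm_le1.
Qed.

(** * Joint cdf's and the symmetry of their cross integrals *)

Lemma measurable_quadrant {R : realType} (z : R * R) :
  measurable (`]-oo, z.1] `*` `]-oo, z.2] : set (R * R)).
Proof. by apply: measurableX; exact: measurable_itv. Qed.

Lemma joint_cdf_norm_le1 {R : realType} (Q : probability (R * R)%type R) z :
  `|joint_cdf Q z| <= 1.
Proof. by apply: fine_probability_norm_le1; exact: measurable_quadrant. Qed.

Lemma fine_joint_cdfK {R : realType} (Q : probability (R * R)%type R) z :
  (joint_cdf Q z)%:E = Q (`]-oo, z.1] `*` `]-oo, z.2]).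
Proof.
by rewrite /joint_cdf fineK// fin_num_measure//; exact: measurable_quadrant.
Qed.

(** Comparison of two points of the plane in the coordinate [c], as a set of pairs: sections of such
    sets are half-planes, and sections of intersections of two are quadrants. Joint cdf's thus
    become measures of sections. *)
Definition below {R : realType} (c : R * R -> R) : set ((R * R) * (R * R)) :=
  [set p | c p.1 <= c p.2].

Lemma measurable_below1 {R : realType} : measurable (@below R fst).
Proof.
apply: (@measurable_le_set _ _ _ (fst \o fst) (fst \o snd)).
  exact: measurableT_comp.
exact: measurableT_comp.
Qed.

Lemma measurable_below2 {R : realType} : measurable (@below R snd).
Proof.
apply: (@measurable_le_set _ _ _ (snd \o fst) (snd \o snd)).
  exact: measurableT_comp.
exact: measurableT_comp.
Qed.

Lemma ysection_below {R : realType} (w : R * R) :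
  ysection (below fst `&` below snd) w = `]-oo, w.1] `*` `]-oo, w.2].
Proof. by rewrite ysectionE; apply/seteqP; split => z /=; rewrite !in_itv. Qed.

Lemma measurable_joint_cdf {R : realType} (Q : probability (R * R)%type R) :
  measurable_fun setT (joint_cdf Q).
Proof.
have -> : joint_cdf Q = fine \o (Q \o ysection (below fst `&` below snd)).
  by apply/funext => w /=; rewrite ysection_below.
apply: measurableT_comp; first exact: fine_measurable.
apply: measurable_fun_ysection; apply: measurableI.
  exact: measurable_below1.
exact: measurable_below2.
Qed.

(** The open and the closed quadrant become the same set once the two lines through [z] are added,
    and these lines are null because the marginals have no atoms. *)
Lemma joint_cdf_atomless_lt {R : realType} (Q : probability (R * R)%type R) z :
  continuous (cdfX Q) -> continuous (cdfY Q) ->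
  Q (`]-oo, z.1[ `*` `]-oo, z.2[) = (joint_cdf Q z)%:E.
Proof.
move=> cX cY; rewrite fine_joint_cdfK.
have mX : measurable (coordX Q @^-1` [set z.1]) by exact: measurable_funPTI.
have mY : measurable (coordY Q @^-1` [set z.2]) by exact: measurable_funPTI.
have mXY : measurable (`]-oo, z.1[ `*` `]-oo, z.2[ : set (R * R)).
  by apply: measurableX; exact: measurable_itv.
have -> : Q (`]-oo, z.1[ `*` `]-oo, z.2[) =
    Q ((`]-oo, z.1[ `*` `]-oo, z.2[) `|`
       (coordX Q @^-1` [set z.1] `|` coordY Q @^-1` [set z.2])).
  rewrite measureU0//; first exact: measurableU.
  by rewrite measureU0//; exact: cdf_atomless.
have -> : Q (`]-oo, z.1] `*` `]-oo, z.2]) =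
    Q ((`]-oo, z.1] `*` `]-oo, z.2]) `|`
       (coordX Q @^-1` [set z.1] `|` coordY Q @^-1` [set z.2])).
  rewrite measureU0//; [exact: measurable_quadrant|exact: measurableU|].
  by rewrite measureU0//; exact: cdf_atomless.
congr (Q _); apply/seteqP; split => w /=; rewrite !in_itv/=.
  by move=> [[/ltW ? /ltW ?]|?]; [left|right].
by rewrite !le_eqVlt => -[[/orP[/eqP|] + /orP[/eqP|]]|]; tauto.
Qed.

(* Inclusion-exclusion for the product of the two laws: off a null set the
   complement of {z <= w} in each coordinate is {w <= z}, and each of these
   sets has measure 1/2. *)
Lemma integral_joint_cdf_sym {R : realType} (Q1 Q2 : probability (R * R)%type R) :
  cdfX Q1 =1 cdfX Q2 -> cdfY Q1 =1 cdfY Q2 ->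
  continuous (cdfX Q1) -> continuous (cdfY Q1) ->
  \int[Q1]_z joint_cdf Q2 z = \int[Q2]_z joint_cdf Q1 z.
Proof.
move=> /funext eX /funext eY cX cY.
have cX2 : continuous (cdfX Q2) by rewrite -eX.
have cY2 : continuous (cdfY Q2) by rewrite -eY.
pose Q := [the probability ((R * R) * (R * R))%type R of (Q1 \x Q2)%E].
have mU := @measurable_below1 R; have mV := @measurable_below2 R.
have QUV : Q (below fst `&` below snd) = (\int[Q2]_z (joint_cdf Q1 z)%:E)%E.
  rewrite /Q/= product_measure_ysection; last exact: measurableI.
  by apply: eq_integral => z _; rewrite ysection_below fine_joint_cdfK.
have QUVC : Q (~` below fst `&` ~` below snd) =
    (\int[Q1]_z (joint_cdf Q2 z)%:E)%E.
  apply: eq_integral => z _ /=.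
  rewrite xsectionE -joint_cdf_atomless_lt//; congr (Q2 _).
  apply/seteqP; split => w /=; rewrite !in_itv/= !ltNge.
    by move=> [/negP -> /negP ->].
  by move=> [/negP ? /negP ?].
have QUC : Q (~` below fst) = (1 / 2)%:E.
  exact: (product_probability_gt (coordX Q1) (coordX Q2)).
have QVC : Q (~` below snd) = (1 / 2)%:E.
  exact: (product_probability_gt (coordY Q1) (coordY Q2)).
have : Q (~` (below fst `&` below snd)) =
    (Q (~` below fst) + Q (~` below snd) - Q (~` below fst `&` ~` below snd))%E.
  rewrite setCI measureUfinr//; [exact: measurableC|exact: measurableC|].
  by rewrite ltey_eq fin_num_measure//; exact: measurableC.
rewrite probability_setC; last exact: measurableI.
rewrite QUV QUVC QUC QVC /Rintegral.
have /fineK <- : (\int[Q1]_z (joint_cdf Q2 z)%:E)%E \is a fin_num.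
  by rewrite -QUVC fin_num_measure//; apply: measurableI; exact: measurableC.
have /fineK <- : (\int[Q2]_z (joint_cdf Q1 z)%:E)%E \is a fin_num.
  by rewrite -QUV fin_num_measure//; exact: measurableI.
by move=> /= [?]; lra.
Qed.

(** * Densities with respect to [mu] and bounds from their differences *)

Lemma density_integrableM {R : realType}
    (mu : {finite_measure set (R * R)%type -> \bar R})
    (Q : probability (R * R)%type R) (f g : R * R -> R) (c : R) :
  has_density mu Q f -> measurable_fun setT g -> (forall z, `|g z| <= c) ->
  mu.-integrable setT (EFin \o (fun z => g z * f z)).
Proof.
move=> [fi _] mg gc; apply: (@integrableMr _ _ _ mu _ _ g (EFin \o f)) => //.
exists c; split; first exact: num_real.
by move=> y cy x _ /=; rewrite (le_trans (gc x))// ltW.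
Qed.

(** Change of variables holds for the Radon-Nikodym derivative of [Q], and [f] equals that
    derivative [mu]-almost everywhere because both integrate to [Q] over every measurable set. *)
Lemma integral_density {R : realType}
    (mu : {finite_measure set (R * R)%type -> \bar R})
    (Q : probability (R * R)%type R) (f g : R * R -> R) (c : R) :
  Q `<< mu -> has_density mu Q f ->
  measurable_fun setT g -> (forall z, `|g z| <= c) ->
  \int[Q]_z g z = \int[mu]_z (g z * f z).
Proof.
move=> Qmu Qf mg gc; have [fi QE] := Qf.
rewrite /Rintegral; congr fine.
rewrite -(Radon_Nikodym_change_of_variables Qmu)//; last exact: bounded_integrable gc.
have RNi := @Radon_Nikodym_integrable _ _ _ (charge_of_finite_measure Q) mu Qmu.
have RNf : ae_eq mu setT (Radon_Nikodym (charge_of_finite_measure Q) mu) (EFin \o f).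
  apply: integral_ae_eq => //; first exact: measurable_int fi.
  move=> E _ mE; rewrite -(@Radon_Nikodym_integral _ _ _ (charge_of_finite_measure Q) mu)//.
  exact: QE.
apply: ae_eq_integral => //.
- apply: emeasurable_funM; first exact/measurable_EFinP.
  exact: measurable_int RNi.
- exact: measurable_int (density_integrableM _ _ _ _ _ Qf mg gc).
- by apply: filterS RNf => z /= RNz zT; rewrite RNz.
Qed.

(** The left side is the integral of [g * (f1 - f2)] against [mu]. The bound serves twice: with [g]
    the indicator of a quadrant, to bound a difference of cdf's, and then with [g] that difference
    itself. *)
Lemma integral_diff_density {R : realType}
    (mu : {finite_measure set (R * R)%type -> \bar R})
    (Q1 Q2 : probability (R * R)%type R) (f1 f2 g : R * R -> R) (c K : R) :
  Q1 `<< mu -> Q2 `<< mu -> has_density mu Q1 f1 -> has_density mu Q2 f2 ->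
  (forall z, `|f1 z - f2 z| <= K) ->
  measurable_fun setT g -> (forall z, `|g z| <= c) ->
  `|integral_diff Q1 Q2 g| <= c * K * fine (mu setT).
Proof.
move=> Q1mu Q2mu Q1f Q2f fK mg gc; rewrite /integral_diff.
rewrite (integral_density _ _ _ _ _ Q1mu Q1f mg gc).
rewrite (integral_density _ _ _ _ _ Q2mu Q2f mg gc).
have i1 := density_integrableM _ _ _ _ _ Q1f mg gc.
have i2 := density_integrableM _ _ _ _ _ Q2f mg gc.
rewrite -RintegralB//.
have i12 : mu.-integrable setT (EFin \o (fun z => g z * f1 z - g z * f2 z)).
  exact: (integrableB _ i1 i2).
rewrite (le_trans (le_normr_Rintegral _ i12))// -Rintegral_cst//.
apply: le_Rintegral => //.
- exact: (integrable_norm i12).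
- exact: (bounded_integrable _ _ `|c * K|).
- move=> z _; rewrite -mulrBr normrM ler_pM//.
Qed.

Lemma joint_cdf_diff_density {R : realType}
    (mu : {finite_measure set (R * R)%type -> \bar R})
    (Q1 Q2 : probability (R * R)%type R) (f1 f2 : R * R -> R) (K : R) z :
  Q1 `<< mu -> Q2 `<< mu -> has_density mu Q1 f1 -> has_density mu Q2 f2 ->
  (forall z, `|f1 z - f2 z| <= K) ->
  `|joint_cdf Q1 z - joint_cdf Q2 z| <= K * fine (mu setT).
Proof.
move=> Q1mu Q2mu Q1f Q2f fK; have mz := measurable_quadrant z.
have FE (Q : probability (R * R)%type R) :
    joint_cdf Q z = \int[Q]_w \1_(`]-oo, z.1] `*` `]-oo, z.2]) w.
  by rewrite /Rintegral integral_indic// setIT.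
(* The indicator of the quadrant is bounded by [c = 1], hence the factor 1 in front of [K]. *)
rewrite !FE -[K]mul1r.
apply: (integral_diff_density _ _ _ _ _ _ _ _ Q1mu Q2mu Q1f Q2f fK).
  exact: measurable_indic.
by move=> w; rewrite indicE; case: (_ \in _); rewrite ?normr0 ?normr1.
Qed.

Lemma derive_bound_lipschitz {R : realType} (A : set R) (f : R -> R) (M a b : R) :
  is_interval A -> A a -> A b ->
  (forall x, A x -> derivable f x 1) ->
  (forall x, A x -> `|derive1 f x| <= M) -> `|f b - f a| <= M * `|b - a|.
Proof.
move=> itvA; wlog ab : a b / a <= b => [wlg Aa Ab df dM|Aa Ab df dM].
  have [ab|/ltW ba] := leP a b; first exact: wlg.
  by rewrite distrC [X in _ * X]distrC; exact: wlg.
have A_ x : x \in `[a, b] -> A x.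
  by rewrite in_itv/= => /andP[ax xb]; apply: (itvA a b) => //; rewrite ax.
have [|x xab|x xab ->] := @MVT_segment R f (derive1 f) a b ab.
- move=> x xab; rewrite derive1E; apply: DeriveDef => //; apply: df; apply: A_.
  exact: subset_itv_oo_cc xab.
- by apply: derivable_within_continuous => y /A_/df.
- by rewrite normrM ler_wpM2r// dM//; exact: A_.
Qed.

(** * Intermediate values of a cdf, and variances of bounded variables *)

Lemma cdf_surj {d} {T : measurableType d} {R : realType}
    {P : probability T R} (X : {RV P >-> R}) (v : R) :
  continuous (fun x => fine (cdf X x)) -> 0 < v < 1 ->
  exists x, fine (cdf X x) = v.
Proof.
move=> cX /andP[v0 v1].
have /fine_cvg/cvgr_gt/(_ v v1) [M1 [_ M1v]] := cvg_cdfy1 X.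
have /fine_cvg/cvgr_lt/(_ v v0) [M0 [_ M0v]] := cvg_cdfNy0 X.
(* The cdf is below [v] left of [M0] and above [v] right of [M1]. Using both numbers in the minimum
   and in the maximum ensures [a <= b]. *)
pose a := Num.min M0 M1 - 1; pose b := Num.max M0 M1 + 1.
have aM0 : a < M0 by rewrite /a ltrBlDr gt_min ltrDl ltr01.
have M1b : M1 < b.
  by rewrite /b (le_lt_trans (_ : _ <= Num.max M0 M1))// ?le_max ?lexx ?orbT// ltrDl.
have ab : a <= b.
  by rewrite /a /b lerBlDr -addrA (le_trans (_ : _ <= Num.max M0 M1))// ?lerDl// le_max ge_min lexx.
have [||x _ xv] := IVT (v := v) ab (f := fun x => fine (cdf X x)).
- exact: continuous_subspaceT.
- by rewrite ge_min le_max (ltW (M0v _ aM0)) (ltW (M1v _ M1b)) orbT.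
- by exists x.
Qed.

Lemma fine_variance {d} {T : measurableType d} {R : realType}
    (P : probability T R) (X : T -> R) :
  fine 'V_P[X] = \int[P]_t (X t - \int[P]_s X s) ^+ 2.
Proof. by rewrite /variance !unlock. Qed.

Lemma integrable_bounded_sqr_sub {d} {T : measurableType d} {R : realType}
    (P : probability T R) (X : T -> R) (m c : R) :
  measurable_fun setT X -> (forall t, `|X t| <= c) ->
  P.-integrable setT (EFin \o (fun t => (X t - m) ^+ 2)).
Proof.
move=> mX Xc; apply: (bounded_integrable _ _ ((c + `|m|) ^+ 2)).
  by apply: measurable_funX; apply: measurable_funB.
move=> t; rewrite normrX lerXn2r ?nnegrE//.
  by rewrite addr_ge0// (le_trans _ (Xc t)).
by rewrite (le_trans (ler_normB _ _))// lerD2r.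
Qed.

Lemma fine_variance_affine {d} {T : measurableType d} {R : realType}
    (P : probability T R) (X : T -> R) (a b c : R) :
  measurable_fun setT X -> (forall t, `|X t| <= c) ->
  fine 'V_P[(fun t => a + b * X t)] = b ^+ 2 * fine 'V_P[X].
Proof.
move=> mX Xc; have iX := bounded_integrable P _ _ mX Xc.
have ibX : P.-integrable setT (EFin \o (fun t => b * X t)).
  exact: (integrableZl measurableT b iX).
rewrite !fine_variance.
have -> : \int[P]_t (a + b * X t) = a + b * \int[P]_t X t.
  rewrite RintegralD//; last exact: (bounded_integrable _ _ `|a|).
  rewrite RintegralZl// Rintegral_cst// [X in fine X](_ : _ = 1%E) ?mulr1//.
  exact: probability_setT.
rewrite -[RHS]RintegralZl//; last exact: (integrable_bounded_sqr_sub _ _ _ c).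
by apply: eq_Rintegral => t _; ring.
Qed.

(** Markov's inequality: [X] dominates [c] times the indicator of [A]. *)
Lemma Rintegral_ge_on {d} {T : measurableType d} {R : realType}
    (P : probability T R) (X : T -> R) (A : set T) (c : R) :
  P.-integrable setT (EFin \o X) -> (forall t, 0 <= X t) ->
  measurable A -> (forall t, A t -> c <= X t) ->
  c * fine (P A) <= \int[P]_t X t.
Proof.
move=> iX X0 mA Ac.
have iA : P.-integrable setT (EFin \o \1_A).
  apply: (bounded_integrable _ _ 1); first exact: measurable_indic.
  by move=> t; rewrite indicE; case: (_ \in _); rewrite ?normr0 ?normr1.
have <- : \int[P]_t \1_A t = fine (P A).
  by rewrite /Rintegral integral_indic// setIT.
rewrite -RintegralZl//; apply: le_Rintegral => //.
  exact: (integrableZl measurableT c iA).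
move=> t _; rewrite indicE; have [tA|_] := boolP (t \in A).
  by rewrite mulr1 Ac// -in_setE.
by rewrite mulr0.
Qed.

(** The mean lies on one side of the midpoint of [q] and [p]. So on [A] or on [B], both of positive
    mass, the deviation from the mean is at least [(p - q) / 2]. *)
Lemma fine_variance_gt0 {d} {T : measurableType d} {R : realType}
    (P : probability T R) (X : T -> R) (A B : set T) (p q c : R) :
  measurable_fun setT X -> (forall t, `|X t| <= c) ->
  measurable A -> measurable B -> 0 < fine (P A) -> 0 < fine (P B) ->
  q < p -> (forall t, A t -> p <= X t) -> (forall t, B t -> X t <= q) ->
  0 < fine 'V_P[X].
Proof.
move=> mX Xc mA mB A0 B0 qp Ap Bq; rewrite fine_variance.
set m := \int[P]_s X s.
have iX := integrable_bounded_sqr_sub P X m c mX Xc.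
have e0 : 0 < ((p - q) / 2) ^+ 2 by rewrite exprn_gt0// divr_gt0// subr_gt0.
have X0 t : 0 <= (X t - m) ^+ 2 by exact: sqr_ge0.
have [mpq|pqm] := leP m ((p + q) / 2).
  apply: lt_le_trans (Rintegral_ge_on _ _ A _ iX X0 mA _).
    exact: (mulr_gt0 e0 A0).
  by move=> t /Ap ?; rewrite lerXn2r// ?nnegrE; lra.
apply: lt_le_trans (Rintegral_ge_on _ _ B _ iX X0 mB _).
  exact: (mulr_gt0 e0 B0).
by move=> t /Bq ?; rewrite -[X in _ <= X]sqrrN lerXn2r// ?nnegrE; lra.
Qed.

(** * The variances of the two statistics under independence *)

Definition kendall_score {R : realType} (Q : probability (R * R)%type R)
    (z : R * R) : R :=
  2 * joint_cdf Q z - cdfX Q z.1 - cdfY Q z.2.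

Lemma measurable_cdfX {R : realType} (Q : probability (R * R)%type R) :
  measurable_fun setT (fun z : R * R => cdfX Q z.1).
Proof. exact: (measurableT_comp (measurable_fine_cdf (coordX Q))). Qed.

Lemma measurable_cdfY {R : realType} (Q : probability (R * R)%type R) :
  measurable_fun setT (fun z : R * R => cdfY Q z.2).
Proof. exact: (measurableT_comp (measurable_fine_cdf (coordY Q))). Qed.

Lemma measurable_kendall_score {R : realType} (Q : probability (R * R)%type R) :
  measurable_fun setT (kendall_score Q).
Proof.
apply: measurable_funB; last exact: measurable_cdfY.
apply: measurable_funB; last exact: measurable_cdfX.
by apply: measurable_funM => //; exact: measurable_joint_cdf.
Qed.

Lemma kendall_score_norm_le {R : realType} (Q : probability (R * R)%type R) z :
  `|kendall_score Q z| <= 4.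
Proof.
have := joint_cdf_norm_le1 Q z; have := cdf_norm_le1 (coordX Q) z.1.
have := cdf_norm_le1 (coordY Q) z.2.
rewrite /kendall_score -/(cdfX Q _) -/(cdfY Q _) !ler_norml.
by move=> /andP[? ?] /andP[? ?] /andP[? ?]; apply/andP; split; lra.
Qed.

Lemma sigma2_T_score {R : realType} (Q : probability (R * R)%type R) :
  sigma2_T Q = 16 * fine 'V_Q[kendall_score Q].
Proof. by []. Qed.

Lemma integral_distribution_cdf {d} {T : measurableType d} {R : realType}
    {P : probability T R} (X : {RV P >-> R}) :
  continuous (fun x => fine (cdf X x)) ->
  \int[distribution P X]_x fine (cdf X x) = 1 / 2.
Proof.
move=> cX; rewrite -(expectation_cdf X cX) /Rintegral integral_distribution//.
  by apply/measurable_EFinP; exact: measurable_fine_cdf.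
apply: (bounded_integrable _ (fun t => fine (cdf X (X t))) 1).
  exact: (measurableT_comp (measurable_fine_cdf X)).
by move=> t; exact: cdf_norm_le1.
Qed.

Lemma integrable_distribution_cdf {d} {T : measurableType d} {R : realType}
    {P : probability T R} (X : {RV P >-> R}) :
  (distribution P X).-integrable setT (EFin \o (fun x => fine (cdf X x))).
Proof.
apply: (bounded_integrable _ _ 1); first exact: measurable_fine_cdf.
by move=> x; exact: cdf_norm_le1.
Qed.

(** A continuous cdf has mean 1/2 under its own law, so with U, V the cdf's at X, Y the variable is
    (1 - U)(1 - V) + U/2 + V/2 = 1 + (2UV - U - V)/2. The factor 1/2 turns 144 into 36. *)
Lemma sigma2_S_score {R : realType} (Q : probability (R * R)%type R) :
  (forall z, joint_cdf Q z = cdfX Q z.1 * cdfY Q z.2) ->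
  continuous (cdfX Q) -> continuous (cdfY Q) ->
  sigma2_S Q = 36 * fine 'V_Q[kendall_score Q].
Proof.
move=> indep cX cY; rewrite /sigma2_S.
have -> : (fun z : R * R => (1 - cdfX Q z.1) * (1 - cdfY Q z.2)
    + \int[distribution Q (coordY Q)]_y joint_cdf Q (z.1, y)
    + \int[distribution Q (coordX Q)]_x joint_cdf Q (x, z.2)) =
    (fun z => 1 + 1 / 2 * kendall_score Q z).
  apply/funext => z.
  have -> : \int[distribution Q (coordY Q)]_y joint_cdf Q (z.1, y) =
      cdfX Q z.1 * (1 / 2).
    rewrite -(integral_distribution_cdf (coordY Q) cY) -RintegralZl//.
      by apply: eq_Rintegral => y _; rewrite indep.
    exact: integrable_distribution_cdf.
  have -> : \int[distribution Q (coordX Q)]_x joint_cdf Q (x, z.2) =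
      cdfY Q z.2 * (1 / 2).
    rewrite -(integral_distribution_cdf (coordX Q) cX) -RintegralZl//.
      by apply: eq_Rintegral => x _; rewrite indep mulrC.
    exact: integrable_distribution_cdf.
  by rewrite /kendall_score indep; field.
rewrite (fine_variance_affine _ _ _ _ 4); last 2 first.
- exact: measurable_kendall_score.
- exact: kendall_score_norm_le.
by rewrite mulrA; congr (_ * _); field.
Qed.

(* With U, V the cdf's evaluated at X, Y, the score is
   2 (U - 1/2) (V - 1/2) - 1/2: at least -3/8 on {U, V <= 1/4} and at most
   -5/8 on {U >= 3/4, V <= 1/4}. *)
Lemma kendall_score_variance_gt0 {R : realType}
    (Q : probability (R * R)%type R) :
  (forall z, joint_cdf Q z = cdfX Q z.1 * cdfY Q z.2) ->
  continuous (cdfX Q) -> continuous (cdfY Q) ->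
  0 < fine 'V_Q[kendall_score Q].
Proof.
move=> indep cX cY.
have q4 : 0 < (1 / 4 : R) < 1 by apply/andP; split; lra.
have [x0 Gx0] := cdf_surj (coordX Q) (1 / 4) cX q4.
have [x1 Gx1] : exists x, cdfX Q x = 3 / 4.
  by apply: (cdf_surj (coordX Q)) => //; apply/andP; split; lra.
have [y0 Hy0] := cdf_surj (coordY Q) (1 / 4) cY q4.
have cdf_nd (X : {RV Q >-> R}) x y : x <= y -> fine (cdf X x) <= fine (cdf X y).
  by move=> xy; rewrite -lee_fin !fine_cdfK cdf_nondecreasing.
have HE y : Q (coordY Q @^-1` `]-oo, y]) = (cdfY Q y)%:E by rewrite fine_cdfK.
have mq (z : R * R) := measurable_quadrant z.
have mH y : measurable (coordY Q @^-1` `]-oo, y]).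
  by apply: measurable_funPTI; exact: measurable_itv.
pose A : set (R * R) := `]-oo, x0] `*` `]-oo, y0].
(* As a half-plane minus a quadrant, [B] has mass 1/4 - (3/4)(1/4) = 1/16; [A] has mass (1/4)(1/4) =
   1/16. *)
pose B : set (R * R) := (coordY Q @^-1` `]-oo, y0]) `\` (`]-oo, x1] `*` `]-oo, y0]).
apply: (fine_variance_gt0 Q _ A B (- (3 / 8)) (- (5 / 8)) 4).
- exact: measurable_kendall_score.
- exact: kendall_score_norm_le.
- exact: (mq (x0, y0)).
- by apply: measurableD => //; exact: (mq (x1, y0)).
- by rewrite -/(joint_cdf Q (x0, y0)) indep /= /cdfX Gx0 /cdfY Hy0; lra.
- rewrite measureD; [|exact: mH|exact: (mq (x1, y0))|by rewrite ltey_eq fin_num_measure].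
  rewrite [X in (_ - X)%E](_ : _ = (joint_cdf Q (x1, y0))%:E); last first.
    rewrite fine_joint_cdfK; congr (Q _).
    by apply/seteqP; split => z /=; rewrite !in_itv/=; tauto.
  rewrite [X in (X - _)%E](_ : _ = (cdfY Q y0)%:E); last exact: HE.
  by rewrite indep /= Gx1 /cdfY Hy0; lra.
- lra.
- move=> z [/= zx zy]; move: zx zy; rewrite !in_itv/= => zx zy.
  have := cdf_nd (coordX Q) _ _ zx; have := cdf_nd (coordY Q) _ _ zy.
  rewrite Gx0 Hy0 /kendall_score indep -/(cdfX Q _) -/(cdfY Q _); nra.
- move=> z [/=]; rewrite !in_itv/= => zy zN.
  have zx : x1 <= z.1.
    by rewrite leNgt; apply/negP => /ltW zx; apply: zN.
  have := cdf_nd (coordX Q) _ _ zx; have := cdf_nd (coordY Q) _ _ zy.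
  rewrite [fine (cdf _ x1)]Gx1 Hy0 /kendall_score indep -/(cdfX Q _) -/(cdfY Q _); nra.
Qed.

(** * Continuity of the marginals, and the shifts of the two means *)

(** The other marginal tends to 1, hence is positive somewhere; dividing the slice of the joint cdf
    at such a point by this value gives the marginal. *)
Lemma independent_cdfX_continuous {R : realType}
    (Q : probability (R * R)%type R) :
  (forall z, joint_cdf Q z = cdfX Q z.1 * cdfY Q z.2) ->
  continuous (joint_cdf Q) -> continuous (cdfX Q).
Proof.
move=> indep cQ x.
have /fine_cvg/cvgr_gt/(_ 0 ltr01) [M [_ MH]] := cvg_cdfy1 (coordY Q).
have H0 : 0 < cdfY Q (M + 1) by apply: MH; rewrite ltrDl.
have -> : cdfX Q = (fun x => joint_cdf Q (x, M + 1) / cdfY Q (M + 1)).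
  by apply/funext => t; rewrite indep /= mulfK// gt_eqF.
apply: cvgMr_tmp; apply: (@continuous_comp _ _ _ (fun t : R => (t, M + 1)) (joint_cdf Q)); last exact: cQ.
by apply: (@cvg_pair _ _ _ _ (nbhs x) (nbhs (M + 1))) => //=; exact: cvg_cst.
Qed.

Lemma independent_cdfY_continuous {R : realType}
    (Q : probability (R * R)%type R) :
  (forall z, joint_cdf Q z = cdfX Q z.1 * cdfY Q z.2) ->
  continuous (joint_cdf Q) -> continuous (cdfY Q).
Proof.
move=> indep cQ y.
have /fine_cvg/cvgr_gt/(_ 0 ltr01) [M [_ MH]] := cvg_cdfy1 (coordX Q).
have H0 : 0 < cdfX Q (M + 1) by apply: MH; rewrite ltrDl.
have -> : cdfY Q = (fun y => joint_cdf Q (M + 1, y) / cdfX Q (M + 1)).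
  by apply/funext => t; rewrite indep /= mulrAC mulfV ?mul1r// gt_eqF.
apply: cvgMr_tmp; apply: (@continuous_comp _ _ _ (fun t : R => (M + 1, t)) (joint_cdf Q)); last exact: cQ.
by apply: (@cvg_pair _ _ _ _ (nbhs (M + 1)) (nbhs y)) => //=; exact: cvg_cst.
Qed.

Lemma integrable_joint_cdf {R : realType} (Q Q' : probability (R * R)%type R) :
  Q.-integrable setT (EFin \o joint_cdf Q').
Proof.
apply: (bounded_integrable _ _ 1); first exact: measurable_joint_cdf.
exact: joint_cdf_norm_le1.
Qed.

Lemma mu_T_Rintegral {R : realType} (Q : probability (R * R)%type R) :
  mu_T Q = 4 * \int[Q]_z joint_cdf Q z - 1.
Proof. by rewrite /mu_T unlock. Qed.

Lemma mu_S_Rintegral {R : realType} (Q : probability (R * R)%type R) :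
  mu_S Q = 12 * \int[Q]_z (cdfX Q z.1 * cdfY Q z.2) - 3.
Proof. by rewrite /mu_S unlock. Qed.

Lemma integral_diff_joint_cdf {R : realType} (Q Q0 : probability (R * R)%type R) :
  integral_diff Q Q0 (fun z => joint_cdf Q z - joint_cdf Q0 z) =
  \int[Q]_z joint_cdf Q z - \int[Q]_z joint_cdf Q0 z
  - (\int[Q0]_z joint_cdf Q z - \int[Q0]_z joint_cdf Q0 z).
Proof.
by rewrite /integral_diff !RintegralB//; exact: integrable_joint_cdf.
Qed.

(** Since the product of the marginals is the cdf of [Q0], [mu_S] integrates that cdf. Symmetry of
    the cross integrals makes [b] its integral against [Q - Q0], and reduces the sum of the
    [integral_diff] term and [2 * b] to the difference of the two integrals of a cdf against its own
    law. *)
Lemma mean_shifts {R : realType} (Q Q0 : probability (R * R)%type R) :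
  cdfX Q =1 cdfX Q0 -> cdfY Q =1 cdfY Q0 ->
  (forall z, joint_cdf Q0 z = cdfX Q0 z.1 * cdfY Q0 z.2) ->
  continuous (cdfX Q0) -> continuous (cdfY Q0) ->
  let b := \int[Q0]_z (joint_cdf Q z - joint_cdf Q0 z) in
  mu_S Q - mu_S Q0 = 12 * b /\
  mu_T Q - mu_T Q0 =
    4 * (integral_diff Q Q0 (fun z => joint_cdf Q z - joint_cdf Q0 z) + 2 * b).
Proof.
move=> eX eY indep cX cY b.
have sym : \int[Q0]_z joint_cdf Q z = \int[Q]_z joint_cdf Q0 z.
  by apply: integral_joint_cdf_sym => // ?; rewrite ?eX ?eY.
have -> : b = \int[Q]_z joint_cdf Q0 z - \int[Q0]_z joint_cdf Q0 z.
  by rewrite /b RintegralB// ?sym//; exact: integrable_joint_cdf.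
have muSE (Q' : probability (R * R)%type R) :
    cdfX Q' =1 cdfX Q0 -> cdfY Q' =1 cdfY Q0 ->
    mu_S Q' = 12 * \int[Q']_z joint_cdf Q0 z - 3.
  move=> eX' eY'; rewrite mu_S_Rintegral; congr (_ * _ - _).
  by apply: eq_Rintegral => z _; rewrite eX' eY' indep.
rewrite !muSE// !mu_T_Rintegral integral_diff_joint_cdf sym.
by split; ring.
Qed.

(** * Passage to the limit *)

Lemma lime_inf_gt0_near {R : realType} (f : R -> \bar R) (a : R) :
  (0 < lime_inf f a)%E ->
  exists2 e : R, 0 < e & \forall x \near a^', (e%:E <= f x)%E.
Proof.
rewrite /lime_inf oppe_gt0 => /ereal_inf_lt[_ [V aV <-]] V0.
have [e e0 Ve] : exists2 e : R, 0 < e &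
    (ereal_sup [set (\- f)%E x | x in V] <= (- e)%:E)%E.
  (* A finite negative supremum [r] of [- f] gives [e = - r]; if the supremum is minus infinity, any
     positive [e] works. *)
  move: V0; case: (ereal_sup _) => [r| |] //=.
    by rewrite lte_fin => r0; exists (- r); rewrite ?oppr_gt0// opprK.
  by move=> _; exists 1; rewrite ?ltr01// leNye.
exists e => //; apply: filterS aV => x Vx.
rewrite -leeN2; apply: le_trans Ve; apply: ereal_sup_ubound.
by exists x.
Qed.

Theorem corollary4p6 (R : realType)
  (Theta Theta0 : set R)
  (P : R -> probability (R * R)%type R)
  (G H : R -> R)
  (mu : {finite_measure set (R * R)%type -> \bar R})
  (f : R -> R * R -> R)
  (Theta_open : open Theta) (Theta_itv : is_interval Theta) (Theta_0 : Theta 0)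
  (F_cont : forall theta, Theta theta -> continuous (joint_cdf (P theta)))
  (F_G : forall theta, Theta theta -> forall x, cdfX (P theta) x = G x)
  (F_H : forall theta, Theta theta -> forall y, cdfY (P theta) y = H y)
  (F0_indep : forall x y, joint_cdf (P 0) (x, y) = G x * H y)
  (Theta0_open : open Theta0) (Theta0_itv : is_interval Theta0)
  (Theta0_0 : Theta0 0) (Theta0_sub : Theta0 `<=` Theta)
  (F_ac : forall theta, Theta0 theta -> P theta `<< mu)
  (F_density : forall theta, Theta0 theta -> has_density mu (P theta) (f theta))
  (f_derivable : forall theta z, Theta0 theta ->
     derivable (fun t => f t z) theta 1)
  (f_deriv_bounded : exists M : R, forall theta z, Theta0 theta ->
     `| derive1 (fun t => f t z) theta | <= M) :
  theta^-1 * integral_diff (P theta) (P 0)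
               (fun z => joint_cdf (P theta) z - joint_cdf (P 0) z)
    @[theta --> 0^'] --> (0 : R)
  /\
  ((0 < lime_inf (fun theta =>
      (`| theta^-1 *
          \int[P 0]_z (joint_cdf (P theta) z - joint_cdf (P 0) z) |)%:E) 0)%E ->
   cvg (mean_shift_ratio P theta @[theta --> 0^']) /\ ARE_TS P = 1).
Proof.
have [M fM] := f_deriv_bounded.
set r := fun theta => integral_diff (P theta) (P 0)
  (fun z => joint_cdf (P theta) z - joint_cdf (P 0) z).
set b := fun theta => \int[P 0]_z (joint_cdf (P theta) z - joint_cdf (P 0) z).
set C := M * fine (mu setT).
(* Each of the two integrations contributes one factor [C * |theta|]: the first bounds the
   difference of the cdf's, the second integrates it against the difference of the densities. *)
have r_bound theta : Theta0 theta -> `|r theta| <= C ^+ 2 * theta ^+ 2.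
  move=> Tt.
  have fL z : `|f theta z - f 0 z| <= M * `|theta|.
    rewrite -[theta in X in _ <= X]subr0.
    apply: (derive_bound_lipschitz _ (fun t => f t z) M 0 theta Theta0_itv) => //.
      by move=> x; exact: f_derivable.
    by move=> x; exact: fM.
  have dF z : `|joint_cdf (P theta) z - joint_cdf (P 0) z| <= M * `|theta| * fine (mu setT).
    exact: (joint_cdf_diff_density _ _ _ _ _ _ _ (F_ac _ Tt) (F_ac _ Theta0_0)
      (F_density _ Tt) (F_density _ Theta0_0) fL).
  rewrite -(real_normK (num_real theta)).
  rewrite (_ : _ * _ = M * `|theta| * fine (mu setT) * (M * `|theta|) * fine (mu setT)).
    apply: (integral_diff_density _ _ _ _ _ _ _ _ (F_ac _ Tt) (F_ac _ Theta0_0)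
      (F_density _ Tt) (F_density _ Theta0_0) fL _ dF).
    by apply: measurable_funB; exact: measurable_joint_cdf.
  by rewrite /C; ring.
have near_Theta0 : \forall t \near 0^', Theta0 t.
  exact/nbhs_dnbhs/open_nbhs_nbhs.
have r0 : theta^-1 * r theta @[theta --> 0^'] --> (0 : R).
  apply/norm_cvg0P.
  apply: (@squeeze_cvgr _ _ _ _ (cst 0) (fun t => C ^+ 2 * `|t|)).
  - near=> t; rewrite normr_ge0/=.
    have t0 : t != 0 by near: t; exact: nbhs_dnbhs_neq.
    rewrite normrM normfV mulrC ler_pdivrMr ?normr_gt0//.
    by rewrite -mulrA -expr2 real_normK ?num_real// r_bound//; near: t.
  - exact: cvg_cst.
  - rewrite -[X in _ --> X](mulr0 (C ^+ 2)) -[X in _ * X](normr0 R).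
    apply: cvgMl_tmp; apply: cvg_norm; apply: cvg_within_filter; exact: cvg_id.
split => // liminf_b.
have indep z : joint_cdf (P 0) z = cdfX (P 0) z.1 * cdfY (P 0) z.2.
  by case: z => x y; rewrite F0_indep F_G// F_H.
have cX := independent_cdfX_continuous _ indep (F_cont _ Theta_0).
have cY := independent_cdfY_continuous _ indep (F_cont _ Theta_0).
have ratio_cvg : mean_shift_ratio P theta @[theta --> 0^'] --> (4 / 9 : R).
  have [e e0 be] := lime_inf_gt0_near _ _ liminf_b.
  (* The ratio [r / b] is written with both terms divided by [theta]: the numerator tends to 0 and
     the denominator stays at least [e] in absolute value. *)
  have rb : (theta^-1 * r theta) / (theta^-1 * b theta) @[theta --> 0^'] --> (0 : R).
    apply/norm_cvg0P.
    apply: (@squeeze_cvgr _ _ _ _ (cst 0) (fun t => `|t^-1 * r t| * e^-1)).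
    - near=> t; rewrite normr_ge0/= normrM normfV ler_wpM2l//.
      rewrite lef_pV2 ?posrE//.
        by rewrite -lee_fin; near: t.
      by rewrite (lt_le_trans e0)// -lee_fin; near: t.
    - exact: cvg_cst.
    - rewrite -[X in _ --> X](mul0r e^-1); apply: cvgMr_tmp.
      exact/norm_cvg0P.
  (* The mean shifts [4 * (r + 2 * b)] and [12 * b] have quotient [(r / b + 2) / 3], and [r / b]
     tends to 0. *)
  have -> : (4 / 9 : R) = ((0 + 2) / 3) ^+ 2 by field.
  apply: (@cvg_trans _ ((((theta^-1 * r theta) / (theta^-1 * b theta) + 2) / 3) ^+ 2
     @[theta --> 0^'])).
    apply: near_eq_cvg; near=> t.
    have t0 : t != 0 by near: t; exact: nbhs_dnbhs_neq.
    have Tt : Theta t by apply: Theta0_sub; near: t.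
    (* Were [b t] zero, [|t^-1 * b t|] would vanish instead of being at least [e]. *)
    have bt0 : b t != 0.
      have : (e%:E <= `|t^-1 * b t|%:E)%E by near: t.
      rewrite lee_fin => /(lt_le_trans e0); rewrite normr_gt0.
      by apply: contra => /eqP ->; rewrite mulr0.
    have [||||| muS muT] := mean_shifts (P t) (P 0).
    - by move=> x; rewrite !F_G.
    - by move=> y; rewrite !F_H.
    - exact: indep.
    - exact: cX.
    - exact: cY.
    rewrite /mean_shift_ratio muS muT -/(r t) -/(b t).
    by field; rewrite t0 bt0.
  have cvg3 : (theta^-1 * r theta / (theta^-1 * b theta) + 2) / 3
      @[theta --> 0^'] --> ((0 + 2) / 3 : R).
    by apply: cvgMr_tmp; apply: cvgD => //; exact: cvg_cst.
  exact: (cvgM cvg3 cvg3).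
split; first by apply/cvg_ex; exists (4 / 9).
rewrite /ARE_TS (cvg_lim _ ratio_cvg)//.
rewrite sigma2_T_score sigma2_S_score//.
(* Positivity of the common variance [v] allows it to cancel in [36 * v / (16 * v) * (4 / 9)]. *)
have := kendall_score_variance_gt0 _ indep cX cY.
by set v := fine _ => v0; field; rewrite gt_eqF.
Unshelve. all: by end_near.
Qed.
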